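(* Let $H$ be a separable infinite-dimensional Hilbert space and let $T \in B(H)$. The following are equivalent: (i) $T$ satisfies the hypothesis of the Hypercyclicity Criterion. (ii) For each pair $U, V$ of non-empty open subsets of $H$ and each neighborhood $W$ of zero in $H$, there is a positive integer $n$ such that both $T^{n}U \cap W \neq \emptyset$ and $T^{n}W \cap V \neq \emptyset$.
   Context: $B(H)$ is the algebra of bounded linear operators on $H$. An operator $T \in B(H)$ satisfies the hypothesis of the Hypercyclicity Criterion if there exist two dense subsets $Y$ and $Z$ of $H$ and a sequence $\{n_k\}_{k\ge 1}$ of positive integers such that: (1) $T^{n_k} y \to 0$ as $k\to\infty$ for every $y \in Y$; and (2) there exist functions $S_{n_k} : Z \to H$ (not assumed linear or continuous) such that for every $z \in Z$, $S_{n_k} z \to 0$ and $T^{n_k} S_{n_k} z \to z$ as $k \to \infty$. The subsets $Y, Z$ are not assumed to be linear subspaces. *)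

(* Defs.v *)
(* Built on Mathematical Components and MathComp-Analysis. *)
From HB Require Import structures.
From mathcomp Require Import all_boot all_order all_algebra.
From mathcomp Require Import sesquilinear complex.
From mathcomp Require Import all_classical all_reals all_analysis.

Set Implicit Arguments.
Unset Strict Implicit.
Unset Printing Implicit Defensive.

Import Order.TTheory GRing.Theory Num.Theory.
Import numFieldNormedType.Exports.

Local Open Scope classical_set_scope.
Local Open Scope ring_scope.
Local Open Scope complex_scope.

(* Hilbert spaces may be real or complex: [scalar_field R k] is R or R[i]. *)
Variant scalar_kind := RealScalar | ComplexScalar.

Definition scalar_field (R : realType) (k : scalar_kind) : numFieldType :=
  match k with
  | RealScalar => (R : numFieldType)
  | ComplexScalar => (R[i] : numFieldType)
  end.

Definition scalar_conj (R : realType) (k : scalar_kind) :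
    scalar_field R k -> scalar_field R k :=
  match k return scalar_field R k -> scalar_field R k with
  | RealScalar => idfun
  | ComplexScalar => @conjc R
  end.

(* An inner product on H, linear in the first argument and conjugate-linear in
   the second, is a [dot : {dot H for @scalar_conj R k}]. With completeness of
   H, the following property makes H a Hilbert space for its own norm. *)
Definition norm_induced_by (K : numFieldType) (H : normedModType K)
    (dot : H -> H -> K) : Prop :=
  forall x : H, `|x| ^+ 2 = dot x x.

Definition separable (X : topologicalType) : Prop :=
  exists2 D : set X, countable D & dense D.

Definition infinite_dimensional (K : fieldType) (V : lmodType K) : Prop :=
  ~ exists (n : nat) (e : 'I_n -> V),
      forall x : V, exists c : 'I_n -> K, x = \sum_(i < n) c i *: e i.

Definition bounded_operator (K : numFieldType) (H : normedModType K)
    (T : {linear H -> H}) : Prop :=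
  exists M : K, forall x : H, `|T x| <= M * `|x|.

(* As in the notation S_{n_k}, the maps S are indexed by the exponents n_k. *)
Definition hypercyclicity_criterion (K : numFieldType) (H : normedModType K)
    (T : H -> H) : Prop :=
  exists (Y Z : set H) (n_ : nat -> nat),
    [/\ dense Y, dense Z, (forall k, (0 < n_ k)%N),
        (forall y, Y y -> iter (n_ k) T y @[k --> \oo] --> (0 : H)) &
        exists S : nat -> Z -> H, forall z : Z,
          S (n_ k) z @[k --> \oo] --> (0 : H) /\
          iter (n_ k) T (S (n_ k) z) @[k --> \oo] --> (val z : H)].

Definition three_open_sets_condition (K : numFieldType) (H : normedModType K)
    (T : H -> H) : Prop :=
  forall U V W : set H,
    open U -> U !=set0 -> open V -> V !=set0 -> nbhs (0 : H) W ->
    exists2 n : nat, (0 < n)%N &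
      ((iter n T @` U) `&` W !=set0) /\ ((iter n T @` W) `&` V !=set0).

(* Main.v *)
(* For the converse, condition (ii) makes T topologically transitive: if u in U
   has T^n u near 0 and w near 0 has T^n w in V, then u + w stays near U and
   T^n (u + w) near V. It also makes the following set of vectors x open and
   dense for every p: for some n > 0 and u, the vectors T^n x, u and T^n u - x
   all have norm below 1/(p+1). By Baire some x has a dense orbit and lies in all
   these sets, giving n_p and u_p with T^(n_p) x -> 0, u_p -> 0 and
   T^(n_p) u_p -> x. The criterion then holds with Y = Z = the orbit of x and
   S_(n_p) (T^j x) = T^j u_p. Exponents may repeat, but no exponent serves
   infinitely many p: this would force T^n x = 0, hence a finite orbit. *)
Require Import Defs.
From mathcomp Require Import all_boot all_order all_algebra.
From mathcomp Require Import sesquilinear complex.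
From mathcomp Require Import all_classical all_reals all_analysis.
Import Order.TTheory GRing.Theory Num.Theory.
Import numFieldNormedType.Exports.
Local Open Scope ring_scope.
Local Open Scope classical_set_scope.
Set Implicit Arguments.
Unset Strict Implicit.
Unset Printing Implicit Defensive.

(** * Archimedean scalars and Baire category *)

(* The order of [R[i]] is partial, so [R[i]] is not an [archiFieldType]. *)
Definition small_invn (K : numFieldType) : Prop :=
  forall e : K, 0 < e -> exists p : nat, p.+1%:R^-1 < e.

Lemma small_invn_scalar_field (R : realType) (k : scalar_kind) :
  small_invn (scalar_field R k).
Proof.
have invn_lt (e : R) : 0 < e -> exists p : nat, p.+1%:R^-1 < e.
  move=> e0; exists (Num.truncn e^-1).
  by rewrite invf_plt ?posrE ?truncnS_gt.
case: k => /= e e0; first exact: invn_lt.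
(* A positive element of [R[i]] has zero imaginary part, so the real case applies. *)
move: e e0 => [er ei]; rewrite ltcE /= => /andP[/eqP -> er0].
have [p pe] := invn_lt er er0; exists p.
suff -> : (p.+1%:R^-1 : R[i]) = (p.+1%:R^-1)%:C%C by rewrite ltcR.
by rewrite fmorphV rmorph_nat.
Qed.

Lemma invnS_gt0 (K : numFieldType) (p : nat) : 0 < (p.+1%:R^-1 : K).
Proof. by rewrite invr_gt0 ltr0n. Qed.

Lemma lef_invnS (K : numFieldType) (p q : nat) :
  (p.+1%:R^-1 <= q.+1%:R^-1 :> K) = (q <= p)%N.
Proof. by rewrite lef_pV2 ?posrE ?ltr0n// ler_nat. Qed.

(* [Baire] is only available over a [realType], which excludes [R[i]]. *)
Lemma baire_numField (K : numFieldType) (V : completeNormedModType K)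
    (F : nat -> set V) :
  small_invn K -> (forall i, open (F i)) -> (forall i, dense (F i)) ->
  dense (\bigcap_i F i).
Proof.
move=> smallK openF denseF.
pose B (ap : V * nat) := closed_ball ap.1 (ap.2.+1%:R^-1 : K).
pose b (ap : V * nat) := ball ap.1 (ap.2.+1%:R^-1 : K).
have shrink (n : nat) (O : set V) : open O -> O !=set0 ->
    exists ap, (n <= ap.2)%N /\ B ap `<=` O.
  move=> oO [x Ox].
  have /nbhs_ballP[e /= e0 xeO] : nbhs x O by exact: open_nbhs_nbhs.
  have [p pe] := smallK (e / 2) (divr_gt0 e0 (ltr0Sn K 1)).
  exists (x, (n + p)%N); split; first exact: leq_addr.
  apply: subset_trans xeO; apply: subset_trans (subset_closure_half e0).
  apply: le_closed_ball; apply: le_trans (ltW pe).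
  by rewrite lef_invnS leq_addl.
(* The ball chosen at stage [n] lies in the previous one and in [F n], with radius at most 1/(n+1),
   so the limit of the centres lies in every [F n]. *)
have next (nap : nat * (V * nat)) :
    exists ap, (nap.1 <= ap.2)%N /\ B ap `<=` b nap.2 `&` F nap.1.
  apply: shrink; first by apply: openI => //; exact: ball_open.
  apply: denseF; last exact: ball_open.
  by exists nap.2.1; apply: ballxx; exact: invnS_gt0.
have [f fP] := choice next.
move=> D D0 oD; have [ap0 [_ ap0D]] := shrink 0%N D oD D0.
pose fix ap n := if n is m.+1 then f (m, ap m) else ap0.
have bB n : b (ap n) `<=` B (ap n) by exact: subset_closed_ball.
have Bb n : B (ap n.+1) `<=` b (ap n).
  by move=> x /(fP (n, ap n)).2[].
have nested n m : (n <= m)%N -> B (ap m) `<=` B (ap n).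
  move=> nm; rewrite -(subnK nm); elim: (m - n)%N => [//|d IH] x xd.
  by apply/IH/bB/Bb.
have aB n : B (ap n) (ap n).1 by apply: closed_ballxx; exact: invnS_gt0.
have /cvg_ex[l al] : cvg ((ap n).1 @[n --> \oo]).
  apply: cauchy_cvg; apply: cauchy_exP => e e0.
  have [N Ne] := smallK e e0.
  (* Stage [N] produces [ap N.+1], so this is the ball of radius at most 1/(N+1). *)
  exists (ap N.+1).1; exists N.+2 => // m /= Nm.
  have : b (ap N.+1) (ap m).1 by apply: Bb; apply: (nested N.+2 m Nm).
  apply: le_ball; apply: le_trans (ltW Ne).
  by rewrite lef_invnS; exact: (fP (N, ap N)).1.
have Bl n : B (ap n) l.
  apply: (@closed_cvg _ _ \oo _ _ (B (ap n)) _ _ l al).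
    exact: closed_ball_closed.
  by exists n => // m /= nm; exact: (nested n m nm).
exists l; split; first exact/ap0D/(Bl 0%N).
by move=> i _; have [] := (fP (i, ap i)).2 _ (Bl i.+1).
Qed.

Lemma dense_seq (X : topologicalType) (x0 : X) :
  separable X -> exists d : nat -> X, dense (range d).
Proof.
move=> [D /pfcard_geP[->|[d]] denseD].
  (* The point [x0] rules out an empty dense set. *)
  by have [|x [_ []]] := denseD setT _ openT; exists x0.
exists d; suff -> : range d = D by [].
exact: image_eq.
Qed.

(* [u_] is indexed by the exponent [n_ p], which may repeat, so a single choice
   must serve every [p] with the same exponent: take the best one. *)
Lemma choose_by_exponent (A : Type) (a : A) (P : nat -> nat -> A -> Prop) :
  (forall p q n u, (p <= q)%N -> P q n u -> P p n u) ->
  (forall p, exists n u, P p n u) ->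
  (forall n, exists p, forall u, ~ P p n u) ->
  exists (n_ : nat -> nat) (u_ : nat -> A), forall p, P p (n_ p) (u_ (n_ p)).
Proof.
move=> mono exP boundP.
have best n : exists u, forall p, (exists v, P p n v) -> P p n u.
  have exN : exists p, `[< forall u, ~ P p n u >].
    by have [p Np] := boundP n; exists p; exact/asboolP.
  (* If the least failing precision is [q.+1], then [q] is the best one attained; if it is 0, none
     is attained and any value will do. *)
  case: (ex_minnP exN) => -[|q] /asboolP Nq minq.
    by exists a => p [v /mono]/(_ 0%N) /(_ (leq0n _))/Nq.
  have [u Pu] : exists u, P q n u.
    apply: contrapT => NPq.
    have /minq : `[< forall u, ~ P q n u >] by apply/asboolP => u Pu; apply: NPq; exists u.
    by rewrite ltnn.
  exists u => p [v Pv]; have [pq|qp] := leqP p q; first exact: mono pq Pu.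
  by case: (Nq v); exact: mono qp Pv.
have [u_ uP] := choice best.
by have [n_ nP] := choice exP; exists n_, u_ => p; exact: uP.
Qed.

(** * Continuity of the operator and its iterates *)

Lemma bounded_operator_continuous (K : numFieldType) (H : normedModType K)
    (T : {linear H -> H}) : bounded_operator T -> continuous T.
Proof.
move=> [M TM] x; apply/cvgrPdist_lt => e e0.
have M1 : 0 < `|M| + 1 by rewrite ltr_wpDl.
near=> y; rewrite -linearB; apply: le_lt_trans (TM _) _.
(* No sign of [M] is given. The product equals its own modulus, so [|M|], increased by 1 to be
   positive, can replace [M]. *)
have Mxy : 0 <= M * `|x - y| by apply: le_trans (TM _).
rewrite -(ger0_norm Mxy) normrM normr_id.
apply: (@le_lt_trans _ _ ((`|M| + 1) * `|x - y|)).
  by rewrite ler_wpM2r// lerDl.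
rewrite mulrC -ltr_pdivlMr//; near: y.
by apply: cvgr_dist_lt; [exact: cvg_id | exact: divr_gt0].
Unshelve. all: by end_near. Qed.

Lemma iter_continuous (X : topologicalType) (f : X -> X) (n : nat) :
  continuous f -> continuous (iter n f).
Proof.
move=> cf; elim: n => [|n IH] x; first exact: cvg_id.
exact: (continuous_comp (IH x) (cf _)).
Qed.

(** * From the criterion to the open sets condition *)

(** With [y] in both [U] and [Y], and [z] in both [V] and [Z], any exponent [n_ k] with [k] large
    works: [y] witnesses the first intersection and [S (n_ k) z] the second. *)
Lemma criterion_three_open_sets (K : numFieldType) (H : normedModType K)
    (T : H -> H) : hypercyclicity_criterion T -> three_open_sets_condition T.
Proof.
move=> [Y [Z [n_ [denseY denseZ n_gt0 TY [S TS]]]]] U V W oU U0 oV V0 W0.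
have [y [Uy Yy]] := denseY U U0 oU.
have [z [Vz Zz]] := denseZ V V0 oV.
have [Sz TSz] := TS (SigSub (mem_set Zz)).
have nVz : nbhs z V by exact: open_nbhs_nbhs.
have : \forall k \near \oo, [/\ W (iter (n_ k) T y),
    W (S (n_ k) (SigSub (mem_set Zz))) &
    V (iter (n_ k) T (S (n_ k) (SigSub (mem_set Zz))))].
  near=> k; split; near: k.
  - exact: (TY y Yy W W0).
  - exact: (Sz W W0).
  - exact: (TSz V nVz).
move=> /filter_ex[k [Wy Wz Vk]]; exists (n_ k) => //; split.
  by exists (iter (n_ k) T y); split=> //; exists y.
by eexists; split; [exists (S (n_ k) (SigSub (mem_set Zz)))|].
Unshelve. all: by end_near. Qed.

(** * From the open sets condition to the criterion *)

Section converse.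
Variables (K : numFieldType) (H : completeNormedModType K) (T : {linear H -> H}).
Hypotheses (smallK : small_invn K) (contT : continuous T).
Hypothesis threeT : three_open_sets_condition T.

Lemma three_open_sets_transitive (U V : set H) :
  open U -> U !=set0 -> open V -> V !=set0 ->
  exists n, (iter n T @` U) `&` V !=set0.
Proof.
move=> oU [u Uu] oV [v Vv].
have near0 (O : set H) x : open O -> O x ->
    exists2 e : K, 0 < e & forall y w, ball x e y -> ball 0 e w -> O (y + w).
  move=> oO Ox; have /nbhs_ballP[e /= e0 xO] : nbhs x O by exact: open_nbhs_nbhs.
  exists (e / 2); first exact: divr_gt0.
  move=> y w; rewrite -!ball_normE /= sub0r normrN => xy we; apply: xO.
  rewrite -ball_normE /= opprD addrA; apply: le_lt_trans (ler_normB _ _) _.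
  by rewrite (splitr e) ltrD.
have [e e0 eU] := near0 U u oU Uu; have [d d0 dV] := near0 V v oV Vv.
(* A single neighborhood of zero must keep [x + w] in [U] and its image in [V]. *)
have W0 : nbhs (0 : H) (ball (0 : H) e `&` ball (0 : H) d).
  by apply: filterI; exact: nbhsx_ballx.
have [||n _ [[_ [[x xe <-] [_ Tx]]] [_ [[w [we _] <-] vd]]]] :=
  threeT (ball_open u e) _ (ball_open v d) _ W0.
- by exists u; exact: ballxx.
- by exists v; exact: ballxx.
exists n, (iter n T (x + w)); split; first by exists (x + w) => //; exact: eU.
suff -> : iter n T (x + w) = iter n T w + iter n T x by exact: dV.
by elim: n {Tx vd} => [|n IH]; rewrite ?iterS ?IH ?linearD// addrC.
Qed.

Definition small_recurrence (x : H) (p n : nat) (u : H) : Prop :=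
  [/\ (0 < n)%N, `|iter n T x| < p.+1%:R^-1, `|u| < p.+1%:R^-1 &
      `|x - iter n T u| < p.+1%:R^-1].

(** The inequalities are strict and the iterate is continuous, so the same [n] and [u] serve all
    nearby points. *)
Lemma open_small_recurrence (p : nat) :
  open [set x | exists n u, small_recurrence x p n u].
Proof.
rewrite openE => x /= [n [u [n0 Tx up Tu]]].
rewrite /interior /=; near=> y; exists n, u; split=> //; near: y.
  exact: (@cvgr_norm_lt _ _ _ _ _ (iter n T) _ (@iter_continuous _ _ n contT x)).
apply: (@cvgr_norm_lt _ _ _ _ _ (fun y => y - iter n T u) (x - iter n T u)) => //.
by apply: cvgB; [exact: cvg_id | exact: cvg_cst].
Unshelve. all: by end_near. Qed.

(* Apply the three open sets condition with [U = V] of diameter below 1/(p+1):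
   then [T^n u] is close to the very [x] in [U] that [T^n] sends near 0. *)
Lemma dense_small_recurrence (p : nat) :
  dense [set x | exists n u, small_recurrence x p n u].
Proof.
move=> O [x Ox] oO.
pose U := O `&` ball x ((p.+1%:R^-1 : K) / 2).
have Ux : U x by split=> //; apply: ballxx; rewrite divr_gt0 ?invnS_gt0.
have oU : open U by apply: openI => //; exact: ball_open.
have [n n0 [[_ [[y [Oy yx] <-] Ty]] [_ [[u up <-] [_ Tu]]]]] :=
  threeT oU (ex_intro _ x Ux) oU (ex_intro _ x Ux)
    (nbhsx_ballx (0 : H) _ (invnS_gt0 K p)).
exists y; split=> //; exists n, u.
move: yx Ty up Tu; rewrite -!ball_normE /= !sub0r !normrN => yx Ty up Tu.
split=> //; rewrite -(subrK x y) -addrA; apply: le_lt_trans (ler_normD _ _) _.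
by rewrite (splitr p.+1%:R^-1) ltrD// distrC.
Qed.

Lemma hypercyclic_small_recurrence :
  separable H -> exists x : H, dense (range (fun n => iter n T x)) /\
    forall p, exists n u, small_recurrence x p n u.
Proof.
move=> /(dense_seq 0)[d denseD].
pose O (ip : nat * nat) := ball (d ip.1) (ip.2.+1%:R^-1 : K).
(* Every pair of a centre and a radius index has a code [m]; the default value merely repeats a
   ball. *)
pose ip m : nat * nat := odflt (0, 0)%N (unpickle m).
pose F m := [set x | exists n, O (ip m) (iter n T x)] `&`
            [set x | exists n u, small_recurrence x m n u].
have oO j : open (O j) by exact: ball_open.
have O0 j : O j !=set0 by exists (d j.1); apply: ballxx; exact: invnS_gt0.
have oF m : open [set x | exists n, O (ip m) (iter n T x)].
  rewrite (_ : mkset _ = \bigcup_n (iter n T @^-1` O (ip m))).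
    apply: bigcup_open => n _; apply: open_comp => // x _.
    exact: iter_continuous.
  by apply/seteqP; split=> x [n]; exists n.
have dF m : dense [set x | exists n, O (ip m) (iter n T x)].
  move=> U U0 oU.
  have [n [_ [[x Ux <-] Ox]]] := three_open_sets_transitive oU U0 (oO (ip m)) (O0 _).
  by exists x; split=> //; exists n.
have [m|m|x [_ Fx]] := @baire_numField K H F smallK _ _ setT (ex_intro _ 0 I) openT.
- by apply: openI => //; exact: open_small_recurrence.
- by apply: denseI => //; exact: dense_small_recurrence.
exists x; split; last by move=> p; have [] := Fx p I.
move=> U U0 oU; have [_ [/[swap] [[i _ <-]] Ud]] := denseD U U0 oU.
have /nbhs_ballP[e /= e0 dU] : nbhs (d i) U by exact: open_nbhs_nbhs.
have [q qe] := smallK e0.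
have [[n]] := Fx (pickle (i, q)) I.
rewrite /ip pickleK /O /= => dx _.
exists (iter n T x); split; last by exists n.
by apply: dU; apply: le_ball dx; exact: ltW.
Qed.

(** Otherwise the orbit stays in the finite, hence closed, set of its first [n.+1] points. By
    density this set is all of [H], which is then finitely generated. *)
Lemma dense_orbit_neq0 (x : H) (n : nat) :
  infinite_dimensional H -> dense (range (fun n => iter n T x)) ->
  iter n T x != 0.
Proof.
move=> infH denseT; apply/eqP => Tn0; apply: infH.
pose e (i : 'I_n.+1) := iter i T x.
have closed_e : closed (range e).
  apply: (iffLR accessible_finite_set_closed).
    exact/hausdorff_accessible/norm_hausdorff.
  exact/finite_image/finite_finset.
exists n.+1, e => y.
have [i _ <-] : range e y.
  apply: contrapT => ney.
  have [_ [/[swap] [[m _ <-]]]] :=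
    denseT (~` range e) (ex_intro _ y ney) (closed_openC closed_e).
  apply; have [mn|nm] := ltnP m n.
    by exists (inord m) => //; rewrite /e inordK // ltnS ltnW.
  exists ord_max => //; rewrite /e /= -(subnK nm) iterD Tn0.
  by elim: (m - n)%N => //= ? <-; rewrite linear0.
exists (fun j => (j == i)%:R).
rewrite (bigD1 i)//= eqxx scale1r big1 ?addr0// => j /negPf ->.
by rewrite scale0r.
Qed.

Lemma three_open_sets_criterion :
  separable H -> infinite_dimensional H -> hypercyclicity_criterion T.
Proof.
move=> sepH infH; have [x [denseT recx]] := hypercyclic_small_recurrence sepH.
have Tx0 n : iter n T x != 0 by exact: dense_orbit_neq0.
have [|//|n|n_ [u_ nuP]] := choose_by_exponent 0 (P := small_recurrence x).
- move=> p q n u pq [n0 Tx uq Tu].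
  by split=> //; (apply: lt_le_trans; [eassumption|]); rewrite lef_invnS.
(* A fixed exponent fails once 1/(p+1) is below the norm of this nonzero iterate. *)
- have Tn0 : 0 < `|iter n T x| by rewrite normr_gt0.
  have [p pT] := smallK Tn0.
  exists p => u [_ Tp _ _].
  by have := lt_trans Tp pT; rewrite ltxx.
have smallcvg (v : nat -> H) (l : H) :
    (forall p, `|l - v p| < p.+1%:R^-1) -> v p @[p --> \oo] --> l.
  move=> vl; apply/cvgrPdist_lt => e e0; have [N Ne] := smallK e0.
  exists N => // m /= Nm; apply: lt_trans Ne; apply: lt_le_trans (vl m) _.
  by rewrite lef_invnS.
have itercvg j (v : nat -> H) (l : H) : v p @[p --> \oo] --> l ->
    iter j T (v p) @[p --> \oo] --> iter j T l.
  by move=> vl; apply: continuous_cvg => //; exact: iter_continuous.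
have iter0 j : iter j T (0 : H) = 0 by elim: j => //= ? ->; rewrite linear0.
exists (range (fun n => iter n T x)), (range (fun n => iter n T x)), n_.
split=> //.
- by move=> k; have [] := nuP k.
(* Powers of [T] commute, so continuity of the [j]-th iterate reduces the limit to the one at
   [x]. *)
- move=> _ [j _ <-]; under eq_fun do rewrite -iterD addnC iterD.
  rewrite -(iter0 j); apply: itercvg; apply: smallcvg => p.
  by rewrite sub0r normrN; have [] := nuP p.
have exj (z : range (fun n => iter n T x)) : exists j, iter j T x = val z.
  by have [j _ jz] := set_mem (valP z); exists j.
have [j_ jP] := choice exj.
exists (fun n z => iter (j_ z) T (u_ n)) => z; split.
  rewrite -(iter0 (j_ z)); apply: itercvg; apply: smallcvg => p.
  by rewrite sub0r normrN; have [] := nuP p.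
under eq_fun do rewrite -iterD addnC iterD.
rewrite -jP; apply: itercvg; apply: smallcvg => p.
by have [] := nuP p.
Qed.

End converse.

Theorem theorem2p6 (R : realType) (k : scalar_kind)
    (H : completeNormedModType (scalar_field R k))
    (dot : {dot H for (@scalar_conj R k)})
    (hdot : norm_induced_by dot)
    (hsep : separable H)
    (hinf : infinite_dimensional H)
    (T : {linear H -> H})
    (hT : bounded_operator T) :
  hypercyclicity_criterion T <-> three_open_sets_condition T.
Proof.
split; first exact: criterion_three_open_sets.
move=> threeT; apply: three_open_sets_criterion => //.
- exact: small_invn_scalar_field.
- exact: bounded_operator_continuous.
Qed.
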